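(* Let $k$ be a rational number with $k\not\equiv0,4,5,11\pmod{12}$. For every integer $t\ne0$, the matrix $M(t)=\rho((T^tS)^3)=(\rho(T)^t\rho(S))^3$ is given by $$M(t)=-\frac12Z_tW_tE+K_t\begin{pmatrix}-\frac18(2Z_t+W_t)&-iG_{12}(Z_t-1)\\-iG_{21}Z_t&\frac14Z_t\end{pmatrix},$$ where $$K_t=C^2\Big((Z_t-1)^2+\frac{4Z_t}{C^2}\Big)=C^2(Z_t-1)^2+4Z_t=W_t^2+4Z_t.$$
   Context: For rational $k$ and integer $j$, ''$k\equiv j\pmod{12}$'' means $k-j\in12\mathbb{Z}$. $E$ is the $2\times2$ identity matrix. Put $\theta=\frac{1+k}{6}\pi$, $C=\csc\theta=1/\sin\theta$, and for $l\in\mathbb{Z}$, $Z_l=e^{2li\theta}$, $W_l=(Z_l-1)C$. Put $$G_{12}=\frac{\sqrt\pi\,\Gamma(\frac{1+k}{6})}{4\Gamma(\frac{2+k}{12})\Gamma(\frac{6+k}{12})},\qquad G_{21}=\frac{\sqrt\pi\,\Gamma(\frac{5-k}{6})}{2\Gamma(\frac{6-k}{12})\Gamma(\frac{10-k}{12})},$$ where $1/\Gamma$ is the entire reciprocal Gamma function, and $$\rho(T)=\begin{pmatrix}1&4iG_{12}(1-Z_1)\\0&Z_1\end{pmatrix},\qquad\rho(S)=\begin{pmatrix}-1&0\\-4iG_{21}&1\end{pmatrix}.$$ For a word in $T,S$, $\rho$ of the word is the corresponding product of these matrices, in the same order. *)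

(* Defs.v *)
From HB Require Import structures.
From mathcomp Require Import all_boot all_order all_algebra.
From mathcomp Require Import all_classical all_reals all_analysis.
From mathcomp Require Import complex.

Set Implicit Arguments.
Unset Strict Implicit.
Unset Printing Implicit Defensive.

Import Order.TTheory GRing.Theory Num.Theory.
Import numFieldNormedType.Exports.

Local Open Scope ring_scope.
Local Open Scope complex_scope.
Local Open Scope classical_set_scope.

(* k = j (mod 12), meaning that k - j lies in 12 Z. *)
Definition congr12 (k : rat) (j : int) : Prop :=
  exists m : int, k - j%:~R = 12%:R * m%:~R.

(* The entire function 1 / Gamma, restricted to the real line, through the
   Euler-Gauss product
     1 / Gamma(x) = lim_n x (x + 1) ... (x + n) / (n! n^x),
   which converges for every x and vanishes exactly at x = 0, -1, -2, ... *)
Definition rGamma (R : realType) (x : R) : R :=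
  limn (fun n : nat =>
    (\prod_(i < n.+1) (x + i%:R)) / (n`!%:R * (n%:R `^ x))).

(* Meaningful away from the poles 0, -1, -2, ...; there, 0^-1 = 0. *)
Definition Gamma (R : realType) (x : R) : R := (rGamma x)^-1.

(* e^(i x) for real x. *)
Definition expi (R : realType) (x : R) : R[i] := cos x +i* sin x.

Definition theta (R : realType) (k : R) : R := (1 + k) / 6%:R * pi.

Definition Csc (R : realType) (k : R) : R[i] := ((sin (theta k))^-1)%:C.

Definition Z_ (R : realType) (k : R) (l : int) : R[i] :=
  expi (2%:R * l%:~R * theta k).

Definition W_ (R : realType) (k : R) (l : int) : R[i] :=
  (Z_ k l - 1) * Csc k.

Definition G12 (R : realType) (k : R) : R[i] :=
  (Num.sqrt pi * Gamma ((1 + k) / 6%:R) / 4%:R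
   * rGamma ((2%:R + k) / 12%:R) * rGamma ((6%:R + k) / 12%:R))%:C.

Definition G21 (R : realType) (k : R) : R[i] :=
  (Num.sqrt pi * Gamma ((5%:R - k) / 6%:R) / 2%:R
   * rGamma ((6%:R - k) / 12%:R) * rGamma ((10%:R - k) / 12%:R))%:C.

(* The matrix with rows (a, b) and (c, d). *)
Definition mx2 (A : Type) (a b c d : A) : 'M[A]_2 :=
  \matrix_(i < 2, j < 2)
    if i == 0 then (if j == 0 then a else b) else (if j == 0 then c else d).

Variant gen := genT | genS.

Definition rho_gen (R : realType) (k : R) (g : gen) : 'M[R[i]]_2 :=
  match g with
  | genT => mx2 1 (4%:R * 'i%C * G12 k * (1 - Z_ k 1)) 0 (Z_ k 1)
  | genS => mx2 (-1) 0 (- (4%:R * 'i%C * G21 k)) 1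
  end.

(* A word g_1^{n_1} ... g_r^{n_r} in T and S is the list of its syllables
   (g_i, n_i), with n_i an arbitrary integer. *)
Definition word := seq (gen * int).

Definition rho (R : realType) (k : R) (w : word) : 'M[R[i]]_2 :=
  \prod_(s <- w) rho_gen k s.1 ^ s.2.

(* (T^t S)^3 *)
Definition wordTtS3 (t : int) : word :=
  flatten (nseq 3 [:: (genT, t); (genS, 1)]).

Definition M_ (R : realType) (k : R) (t : int) : 'M[R[i]]_2 :=
  rho k (wordTtS3 t).

Definition K_ (R : realType) (k : R) (t : int) : R[i] :=
  Csc k ^+ 2 * ((Z_ k t - 1) ^+ 2 + 4%:R * Z_ k t / Csc k ^+ 2).

(* Main.v *)
(* The matrix [rho(T)^t rho(S)] has determinant [-Z_t], and trace [-W_t / 2]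
   as soon as [16 G12 G21 = 1 + C / 2]; its cube is then the stated one. That
   relation is Euler's reflection formula
   [1/Gamma(x) * 1/Gamma(1 - x) = sin (pi x) / pi], used at [(1 + k)/6],
   [(2 + k)/12] and [(6 + k)/12]. The reflection formula follows from Gauss's
   product for [1/Gamma] and from the sine product, which is obtained from the
   integrals [I_n(y)] of [cos t ^ (2n) * cos (y t)] over [[0, pi/2]]: one has
   [((2n + 2)^2 - y^2) I_(n+1)(y) = (2n + 2) (2n + 1) I_n(y)], and
   [I_n(y) / I_n(0)] tends to 1. *)
Require Import Defs.
From HB Require Import structures.
From mathcomp Require Import all_boot all_order all_algebra.
From mathcomp Require Import all_classical all_reals all_analysis.
From mathcomp Require Import complex ring lra.
Import Order.TTheory GRing.Theory Num.Theory.
Import numFieldNormedType.Exports.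
Local Open Scope ring_scope.
Local Open Scope complex_scope.

Section ClosedForm.
Set Implicit Arguments.
Unset Strict Implicit.
Unset Printing Implicit Defensive.
Variable R : realType.
Implicit Types x y t l : R.

(* Not a class, so that applying the rules below triggers no instance search. *)
Definition has_deriv (f : R -> R) t a : Prop := is_derive t 1 f a.

(** * Differentiation rules *)

Section DerivRules.
Variables (f g : R -> R) (t a b : R).
Hypotheses (df : has_deriv f t a) (dg : has_deriv g t b).
Lemma has_deriv_eq : a = b -> has_deriv f t b.
Proof. by move=> <-. Qed.
Lemma has_derivD : has_deriv (fun s => f s + g s) t (a + b).
Proof. exact: is_deriveD. Qed.
Lemma has_derivB : has_deriv (fun s => f s - g s) t (a - b).
Proof. exact: is_deriveB. Qed.
Lemma has_derivM : has_deriv (fun s => f s * g s) t (f t * b + g t * a).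
Proof. exact: is_deriveM. Qed.
Lemma has_derivX n : has_deriv (fun s => f s ^+ n) t (n%:R * f t ^+ n.-1 * a).
Proof. by have := @is_deriveX _ _ f n t 1 a df; rewrite exprfctE. Qed.
Lemma has_derivZ c : has_deriv (fun s => c * f s) t (c * a).
Proof. exact: is_deriveZ. Qed.
Lemma has_deriv_divr c : has_deriv (fun s => f s / c) t (a / c).
Proof. rewrite mulrC; under eq_fun do rewrite mulrC. exact: has_derivZ. Qed.
End DerivRules.

Lemma has_deriv_sin t : has_deriv sin t (cos t).
Proof. exact: is_derive_sin. Qed.

Lemma has_deriv_cos t : has_deriv cos t (- sin t).
Proof. exact: is_derive_cos. Qed.

Lemma has_deriv_sinM y t : has_deriv (fun s => sin (y * s)) t (y * cos (y * t)).
Proof.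
rewrite mulrC; apply: (@is_derive1_comp _ sin (fun s => y * s)).
by rewrite -[X in is_derive _ _ _ X]mulr1; exact: is_deriveZ.
Qed.

Lemma has_deriv_cosM y t : has_deriv (fun s => cos (y * s)) t (- (y * sin (y * t))).
Proof.
rewrite mulrC -mulNr; apply: (@is_derive1_comp _ cos (fun s => y * s)).
by rewrite -[X in is_derive _ _ _ X]mulr1; exact: is_deriveZ.
Qed.

(** * Primitives of even cosine powers times [cos (y * t)] *)

(* The primitive of [cos t ^ (2 n) * cos (y * t)] vanishing at 0, by the
   reduction formula coming from two integrations by parts. *)
Fixpoint cosPrim y (n : nat) t : R :=
  if n is n'.+1 then
    let m : R := n.*2%:R in
    (m * (m - 1) * cosPrim y n' t
     + m * (cos t ^+ n'.*2.+1 * (sin t * cos (y * t)))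
     - y * (cos t ^+ n.*2 * sin (y * t))) / (m ^+ 2 - y ^+ 2)
  else if y == 0 then t else sin (y * t) / y.

Lemma has_deriv_cosPrim y n t : (forall i, (i < n)%N -> i.+1.*2%:R ^+ 2 - y ^+ 2 != 0 :> R) ->
  has_deriv (cosPrim y n) t (cos t ^+ n.*2 * cos (y * t)).
Proof.
elim: n => [_|n IH yn] /=.
  rewrite expr0 mul1r; case: eqVneq => [->|y0].
    by rewrite mul0r cos0; exact: is_derive_id.
  rewrite -[X in has_deriv _ _ X](mulfK y0) [X in X / _]mulrC.
  exact/has_deriv_divr/has_deriv_sinM.
have yn0 := yn n (ltnSn n).
apply: has_deriv_eq.
  apply: has_deriv_divr; apply: has_derivB.
    apply: has_derivD.
      by apply: has_derivZ; apply: IH => i ii; exact/yn/ltnW.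
    apply: has_derivZ; apply: has_derivM; first by apply: has_derivX; exact: has_deriv_cos.
    by apply: has_derivM; [exact: has_deriv_sin|exact: has_deriv_cosM].
  apply: has_derivZ; apply: has_derivM; first by apply: has_derivX; exact: has_deriv_cos.
  exact: has_deriv_sinM.
rewrite /=.
have := cos2Dsin2 t.
set c := cos t; set s := sin t; set C := cos _; set S := sin _.
move=> cs.
apply: (mulIf yn0); rewrite mulfVK//.
set m : R := n.*2.+2%:R.
have -> : n.*2.+1%:R = m - 1 by rewrite -[m]natr1 addrK.
rewrite !exprS.
set p := c ^+ n.*2.
have s2 : s ^+ 2 = 1 - c ^+ 2 by rewrite -cs; ring.
(* Both sides agree as polynomials modulo [sin^2 = 1 - cos^2]. *)
ring: s2.
Qed.

Lemma cosPrim0 y n : cosPrim y n 0 = 0.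
Proof.
elim: n => [|n IH] /=; last by rewrite IH !(mulr0, sin0, mul0r, addr0, subr0).
by rewrite mulr0 sin0 mul0r if_same.
Qed.

(** The integral over [0, pi/2], encoded as the value of the primitive vanishing at 0. Inequalities
    between such integrals become monotonicity statements about primitives. *)
Definition cosInt y n : R := cosPrim y n (pi / 2).

(** Both boundary terms of the reduction formula carry a positive power of [cos], which vanishes at
    pi/2. *)
Lemma cosIntS y n : let m : R := n.+1.*2%:R in
  cosInt y n.+1 = m * (m - 1) / (m ^+ 2 - y ^+ 2) * cosInt y n.
Proof.
rewrite /cosInt /= cos_pihalf !expr0n/= !mul0r !mulr0 subr0 addr0.
by rewrite mulrAC.
Qed.

(** * Monotonicity and elementary trigonometric inequalities *)

(** A consequence of the mean value theorem, standing in for the monotonicity of the integral. *)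
Lemma deriv_ge0_le (f df : R -> R) a b : a <= b ->
  (forall t, has_deriv f t (df t)) -> (forall t, a <= t <= b -> 0 <= df t) ->
  f a <= f b.
Proof.
move=> ab fdf df0.
have fc : {within `[a, b], continuous f}%classic.
  apply: continuous_subspaceT => t.
  apply: differentiable_continuous; apply/derivable1_diffP.
  by case: (fdf t).
have [c cab /eqP] := MVT_segment ab (fun t _ => fdf t) fc.
rewrite subr_eq => /eqP ->.
by rewrite lerDr mulr_ge0 ?subr_ge0// df0// -in_itv.
Qed.

Lemma sin_le (u : R) : 0 <= u -> sin u <= u.
Proof.
move=> u0; rewrite -subr_ge0 -[X in X <= _](subrr (0 : R)) -[X in _ - X <= _]sin0.
apply: (@deriv_ge0_le (fun t : R => t - sin t) (fun t => 1 - cos t)) => // t.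
  by apply: has_derivB; [exact: (@is_derive_id R R)|exact: has_deriv_sin].
Qed.

Lemma one_sub_cos_le (u : R) : 1 - cos u <= u ^+ 2 / 2.
Proof.
wlog u0 : u / 0 <= u.
  move=> H; have [|/ltW u0] := leP 0 u; first exact: H.
  by rewrite -cosN -sqrrN; apply: H; rewrite oppr_ge0.
rewrite -subr_ge0.
pose f t : R := t ^+ 2 / 2 - (1 - cos t).
rewrite -[X in _ <= X]/(f u) [X in X <= _](_ : _ = f 0); last first.
  by rewrite /f cos0 expr0n/= subrr mul0r subr0.
apply: (@deriv_ge0_le f (fun t => t - sin t)) => // t.
  apply: has_deriv_eq.
    apply: has_derivB.
      by apply: has_deriv_divr; apply: has_derivX; exact: is_derive_id.
    by apply: has_derivB; [exact: is_derive_cst|exact: has_deriv_cos].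
  by rewrite /=; field.
by move=> /andP[t0 _]; rewrite subr_ge0 sin_le.
Qed.

Lemma mulr_cos_le_sin t : 0 <= t <= pi / 2 -> t * cos t <= sin t.
Proof.
move=> /andP[t0 tpi]; rewrite -subr_ge0.
pose f t : R := sin t - t * cos t.
rewrite -[X in _ <= X]/(f t) [X in X <= _](_ : _ = f 0); last first.
  by rewrite /f sin0 mul0r subr0.
apply: (@deriv_ge0_le f (fun t => t * sin t)) => // u.
  apply: has_deriv_eq.
    apply: has_derivB; first exact: has_deriv_sin.
    by apply: has_derivM; [exact: is_derive_id|exact: has_deriv_cos].
  by rewrite /=; ring.
move=> /andP[u0 ut]; rewrite mulr_ge0 ?sin_ge0_pi// u0/=.
by have := pi_gt0 R; lra.
Qed.

(** * Asymptotics of the cosine integrals *)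

Lemma even_sqr_neq0 i : i.+1.*2%:R ^+ 2 - 0 ^+ 2 != 0 :> R.
Proof. by rewrite expr0n subr0 expf_eq0/= pnatr_eq0. Qed.

(** The integrands compare pointwise: [1 - cos (y t) <= (y t)^2 / 2] and [t cos t <= sin t] bound
    [cos^(2n+2) (1 - cos (y t))] by [y^2 / 2] times [cos^(2n) sin^2], and the latter product is
    [cos^(2n) - cos^(2n+2)]. *)
Lemma cosInt_bounds y n : (forall i, i.+1.*2%:R ^+ 2 - y ^+ 2 != 0 :> R) ->
  0 <= cosInt 0 n.+1 - cosInt y n.+1 <= y ^+ 2 / 2 * (cosInt 0 n - cosInt 0 n.+1).
Proof.
move=> yn.
have d0 m t := has_deriv_cosPrim t (fun i (_ : (i < m)%N) => even_sqr_neq0 i).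
have dy m t := has_deriv_cosPrim t (fun i (_ : (i < m)%N) => yn i).
have pi0 : 0 <= pi / 2 :> R by rewrite divr_ge0 ?pi_ge0.
have cge0 t : 0 <= t <= pi / 2 -> 0 <= cos t.
  by move=> /andP[t0 tp]; apply: cos_ge0_pihalf; rewrite tp andbT; lra.
apply/andP; split.
  pose f t := cosPrim 0 n.+1 t - cosPrim y n.+1 t.
  rewrite -[X in _ <= X]/(f (pi / 2)) [X in X <= _](_ : _ = f 0); last first.
    by rewrite /f !cosPrim0 subrr.
  pose c m y t : R := cos t ^+ m.*2 * cos (y * t).
  apply: (@deriv_ge0_le f (fun t => c n.+1 0 t - c n.+1 y t) _ _ pi0) => t.
    exact: has_derivB.
  move=> tp; rewrite /c -mulrBr mulr_ge0 ?exprn_ge0 ?cge0//.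
  by rewrite mul0r cos0 subr_ge0 cos_le1.
rewrite -subr_ge0.
pose f t := y ^+ 2 / 2 * (cosPrim 0 n t - cosPrim 0 n.+1 t) - (cosPrim 0 n.+1 t - cosPrim y n.+1 t).
rewrite -[X in _ <= X]/(f (pi / 2)) [X in X <= _](_ : _ = f 0); last first.
  by rewrite /f !cosPrim0 !subrr mulr0 subrr.
pose c m y t : R := cos t ^+ m.*2 * cos (y * t).
apply: (@deriv_ge0_le f (fun t => y ^+ 2 / 2 * (c n 0 t - c n.+1 0 t)
  - (c n.+1 0 t - c n.+1 y t)) _ _ pi0) => t.
  apply: has_derivB; last exact: has_derivB.
  by apply: has_derivZ; exact: has_derivB.
move=> tp; have /andP[t0 _] := tp.
rewrite /c mul0r cos0 !mulr1 doubleS !(exprS (cos t)).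
have -> : forall a d : R, y ^+ 2 / 2 * (a - cos t * (cos t * a))
  - (cos t * (cos t * a) - cos t * (cos t * a) * d)
  = a * (y ^+ 2 / 2 * (1 - cos t ^+ 2) - cos t ^+ 2 * (1 - d)) by move=> *; ring.
rewrite mulr_ge0 ?exprn_ge0 ?cge0// -sin2cos2 subr_ge0.
apply: (@le_trans _ _ (cos t ^+ 2 * ((y * t) ^+ 2 / 2))).
  by rewrite ler_wpM2l ?sqr_ge0// one_sub_cos_le.
have : (t * cos t) ^+ 2 <= sin t ^+ 2.
  by rewrite lerXn2r ?nnegrE ?mulr_cos_le_sin ?mulr_ge0 ?cge0//
    (le_trans _ (mulr_cos_le_sin tp))// mulr_ge0 ?cge0.
have : 0 <= y ^+ 2 / 2 by rewrite divr_ge0 ?sqr_ge0.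
move=> h1 h2; have := ler_wpM2l h1 h2; congr (_ <= _); ring.
Qed.

Lemma cosInt0_gt0 n : 0 < cosInt (0 : R) n.
Proof.
elim: n => [|n IH]; first by rewrite /cosInt /= eqxx divr_gt0 ?pi_gt0.
rewrite cosIntS mulr_gt0// expr0n subr0 divr_gt0 ?mulr_gt0 ?exprn_gt0 ?ltr0n//.
Qed.

(** With [y = 0] the recurrence factor is [(2n+1)/(2n+2)]. After division by [cosInt 0 n.+1], the
    upper bound of [cosInt_bounds] is thus of order [1/n]. *)
Lemma cosInt0_subS n :
  cosInt (0 : R) n - cosInt 0 n.+1 = cosInt 0 n.+1 / n.*2.+1%:R.
Proof.
rewrite cosIntS/= expr0n subr0 doubleS -[n.*2.+2%:R]natr1 addrK.
have : n.*2.+1%:R + 1 != 0 :> R by rewrite natr1 pnatr_eq0.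
have : n.*2.+1%:R != 0 :> R by rewrite pnatr_eq0.
by move: (n.*2.+1%:R : R) => a a0 a1; field; rewrite a0.
Qed.

(** Dividing the recurrences for [y = 2x] and [y = 0] leaves the inverse of one factor of the sine
    product, so the ratio times the partial product does not depend on [n]. *)
Lemma cosInt_ratioS x n : n.+1%:R ^+ 2 != x ^+ 2 ->
  cosInt (2 * x) n.+1 / cosInt 0 n.+1 * (1 - x ^+ 2 / n.+1%:R ^+ 2) =
  cosInt (2 * x) n / cosInt 0 n.
Proof.
move=> xn.
have := lt0r_neq0 (cosInt0_gt0 n).
rewrite !cosIntS -muln2 natrM expr0n subr0.
have : n.+1%:R * 2 - 1 != 0 :> R.
  by rewrite subr_eq0 -natrM pnatr_eq1 muln2.
have : n.+1%:R != 0 :> R by rewrite pnatr_eq0.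
move: xn; move: (n.+1%:R : R) (cosInt _ _) (cosInt _ _) => a I J ax a0 a1 J0.
rewrite -subr_eq0 in ax.
have ax4 : (a * 2) ^+ 2 - (2 * x) ^+ 2 != 0.
  have -> : (a * 2) ^+ 2 - (2 * x) ^+ 2 = 4 * (a ^+ 2 - x ^+ 2) by ring.
  by rewrite mulf_neq0.
by field; rewrite ?J0 ?a0 ?a1 ?ax4.
Qed.

Lemma cvg_cosInt_ratio y : (forall i, i.+1.*2%:R ^+ 2 - y ^+ 2 != 0 :> R) ->
  (cosInt y n / cosInt 0 n @[n --> \oo] --> (1 : R))%classic.
Proof.
move=> yn; rewrite -cvg_shiftS.
apply: (@squeeze_cvgr _ _ _ _ (fun n : nat => 1 - y ^+ 2 / 2 * (n.+1%:R^-1 : R)) (fun=> 1)).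
- apply: nearW => n /=.
  have J0 := cosInt0_gt0 n.+1.
  have /andP[] := cosInt_bounds n yn.
  rewrite cosInt0_subS subr_ge0 => h1 h2.
  rewrite ler_pdivrMr// mul1r h1 andbT ler_pdivlMr// mulrBl mul1r.
  rewrite lerBlDr -lerBlDl (le_trans h2)// -[leRHS]mulrA ler_wpM2l ?divr_ge0 ?sqr_ge0//.
  (* The bound [1/(2n+1)] is weakened to [1/(n+1)] to use the harmonic sequence. *)
  rewrite mulrC ler_pM2r// lef_pV2 ?posrE ?ltr0n// ler_nat ltnS -addnn.
  exact: leq_addr.
- rewrite -[X in (_ --> X)%classic]subr0 -[X in _ - X](mulr0 (y ^+ 2 / 2)).
  apply: cvgB; first exact: cvg_cst.
  apply: cvgM; first exact: cvg_cst.
  exact: cvg_harmonic.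
- exact: cvg_cst.
Qed.

(** * Euler's sine product *)

Lemma sin_natrM_pi n : sin (n%:R * pi) = 0 :> R.
Proof.
elim: n => [|n IH]; first by rewrite mul0r sin0.
by rewrite -natr1 mulrDl mul1r sinDpi IH oppr0.
Qed.

(** If [x] is a nonzero integer, some factor vanishes and so does the sine. Otherwise no denominator
    of the recurrence vanishes, and the partial product is a constant divided by a ratio tending to
    1. *)
Lemma cvg_sine_product x :
  (x * \prod_(i < n) (1 - x ^+ 2 / i.+1%:R ^+ 2) @[n --> \oo] --> sin (pi * x) / pi)%classic.
Proof.
have pi0 : pi != 0 :> R by rewrite gt_eqF ?pi_gt0.
have [[i /eqP ix]|/forallNP nx] := pselect (exists i : nat, i.+1%:R ^+ 2 == x ^+ 2).
  have -> : sin (pi * x) = 0.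
    move/eqP: ix; rewrite eqf_sqr => /orP[|]; last rewrite -eqr_oppLR.
      by move=> /eqP <-; rewrite mulrC sin_natrM_pi.
    by move=> /eqP <-; rewrite mulrN sinN mulrC sin_natrM_pi oppr0.
  rewrite mul0r; apply: cvg_near_cst; near=> n.
  have iln : (i < n)%N by near: n; exact: nbhs_infty_gt.
  rewrite (bigD1 (Ordinal iln))//= -ix divff ?subrr ?mul0r ?mulr0//.
have yn i : i.+1.*2%:R ^+ 2 - (2 * x) ^+ 2 != 0 :> R.
  rewrite -muln2 natrM mulrC !exprMn -mulrBr mulf_neq0//.
  by rewrite subr_eq0; exact/negP/nx.
have rP n : cosInt (2 * x) n / cosInt 0 n * \prod_(i < n) (1 - x ^+ 2 / i.+1%:R ^+ 2)
    = cosInt (2 * x) 0 / cosInt 0 0.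
  elim: n => [|n IH]; first by rewrite big_ord0 mulr1.
  rewrite big_ord_recr/= [X in _ * X]mulrC mulrA cosInt_ratioS//.
  exact/negP/nx.
have r1 := cvg_cosInt_ratio yn.
(* The integrals for [n = 0] are explicit: [sin (pi x) / (2x)] at [y = 2x] when [x] is nonzero, and
   [pi / 2] at [y = 0]. *)
have -> : sin (pi * x) / pi = x * (cosInt (2 * x) 0 / cosInt 0 0) / 1.
  rewrite /cosInt /= eqxx mulf_eq0 pnatr_eq0/=.
  have -> : 2 * x * (pi / 2) = pi * x by field.
  have [->|x0] := eqVneq x 0; first by rewrite mulr0 sin0 !mul0r.
  by move: pi0; move: (sin _) => s; move: (@pi R) => p p0; field; rewrite x0 p0.
pose c : R := x * (cosInt (2 * x) 0 / cosInt 0 0).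
have cr : (c / (cosInt (2 * x) n / cosInt 0 n) @[n --> \oo] --> c / 1)%classic.
  by apply: cvgM; [exact: cvg_cst|apply: cvgV => //; exact: oner_neq0].
apply: cvg_trans cr; apply: near_eq_cvg; near=> n.
have r0 : 0 < cosInt (2 * x) n / cosInt 0 n.
  by near: n; exact: (cvgr_gt (1 : R)).
by rewrite /c -(rP n) mulrCA [X in X / _]mulrC mulfK// gt_eqF.
Unshelve. all: by end_near.
Qed.

(** * Convergence of Gauss's product *)

(** Convexity of [exp] between [ln u] and 0, with weights [x] and [1 - x]. *)
Lemma powR_le_affine (u x : R) : 0 < u -> 0 <= x <= 1 -> u `^ x <= 1 + x * (u - 1).
Proof.
move=> u0 /andP[x0 x1].
have := convex_expR (Itv01 x0 x1) (ln u) 0.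
rewrite !convRE /= expR0 lnK ?posrE// mulr0 addr0 mulr1 /unstable.onem.
rewrite /powR gt_eqF//; lra.
Qed.

Definition gauss_prod x (n : nat) : R :=
  (\prod_(i < n.+1) (x + i%:R)) / (n`!%:R * (n%:R `^ x)).

(** Indices start at 1, so that the bases of the real powers are positive. *)
Lemma gauss_prodS x n : gauss_prod x n.+2 = gauss_prod x n.+1 *
  ((1 + x / n.+2%:R) * (n.+1%:R / n.+2%:R) `^ x).
Proof.
rewrite /gauss_prod big_ord_recr/= [n.+2`!]factS natrM.
have -> : (n.+1%:R / n.+2%:R) `^ x = n.+1%:R `^ x / n.+2%:R `^ x :> R.
  rewrite powRM ?ler0n ?invr_ge0 ?ler0n// -powR_inv1 ?ler0n//.
  by rewrite -powRrM mulN1r powRN.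
set a := n.+1%:R `^ x; set b := n.+2%:R `^ x.
have a0 : a != 0 by rewrite gt_eqF ?powR_gt0 ?ltr0n.
have b0 : b != 0 by rewrite gt_eqF ?powR_gt0 ?ltr0n.
have f0 : (n.+1)`!%:R != 0 :> R by rewrite pnatr_eq0 -lt0n fact_gt0.
have n0 : n.+2%:R != 0 :> R by rewrite pnatr_eq0.
move: f0 n0 a0 b0; move: a b (n.+2%:R : R) (_`!%:R : R) => a b c d.
by move=> d0 c0 a0 b0; field; rewrite ?a0 ?b0 ?c0 ?d0.
Qed.

(** On [0, 1] the sequence is nonnegative and, from index 1 on, nonincreasing: with [v = 1/(n+2)],
    the quotient of successive terms is [(1 + x v) (1 - v)^x <= (1 + x v) (1 - x v) <= 1]. *)
Lemma cvg_gauss_prod01 x : 0 <= x <= 1 ->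
  exists l, (gauss_prod x n @[n --> \oo] --> l)%classic.
Proof.
move=> x01; have /andP[x0 x1] := x01.
have G0 n : 0 <= gauss_prod x n.
  rewrite /gauss_prod divr_ge0 ?mulr_ge0 ?powR_ge0//.
  by apply: prodr_ge0 => i _; rewrite addr_ge0.
exists (limn (fun n => gauss_prod x n.+1)); rewrite -cvg_shiftS.
apply: nonincreasing_is_cvgn; last first.
  by exists 0 => _ [n _ <-]; exact: G0.
apply/nonincreasing_seqP => n; rewrite /= gauss_prodS ler_piMr//.
have n2 : 0 < n.+2%:R :> R by rewrite ltr0n.
have -> : n.+1%:R / n.+2%:R = 1 - n.+2%:R^-1 :> R.
  by rewrite -[X in X / _](addrK 1) natr1 mulrBl divff ?gt_eqF// mul1r.
set v := n.+2%:R^-1.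
have v0 : 0 < v by rewrite invr_gt0.
have v1 : 0 < 1 - v by rewrite subr_gt0 invf_lt1// ltr1n.
have h := powR_le_affine v1 x01.
have h0 : 0 <= 1 + x * v by rewrite addr_ge0// mulr_ge0// ltW.
apply: (le_trans (ler_wpM2l h0 h)).
have : 0 <= (x * v) ^+ 2 by exact: sqr_ge0.
nra.
Qed.

Lemma cvg_shift_ratio x : ((x + n.+1%:R) / n.+1%:R @[n --> \oo] --> (1 : R))%classic.
Proof.
have : (1 + x * n.+1%:R^-1 @[n --> \oo] --> (1 + x * 0 : R))%classic.
  apply: cvgD; first exact: cvg_cst.
  by apply: cvgM; [exact: cvg_cst|exact: cvg_harmonic].
rewrite mulr0 addr0; apply: cvg_trans; apply: near_eq_cvg; apply: nearW => n /=.
by rewrite mulrDl divff ?pnatr_eq0// addrC.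
Qed.

(** The functional equation [1/Gamma(x) = x / Gamma(x + 1)] at finite level, up to a factor tending
    to 1. It carries convergence between [x] and [x + 1] in both directions. *)
Lemma gauss_prod_shift x n :
  gauss_prod x n.+1 * ((x + 1 + n.+1%:R) / n.+1%:R) = x * gauss_prod (x + 1) n.+1.
Proof.
rewrite /gauss_prod big_ord_recl/= addr0 [in RHS]big_ord_recr/=.
rewrite powRD ?pnatr_eq0 ?implybT// powRr1 ?ler0n//.
have -> : \prod_(i < n.+1) (x + (bump 0 i)%:R) = \prod_(i < n.+1) (x + 1 + i%:R).
  by apply: eq_bigr => i _; rewrite /bump /= add1n -addrA nat1r.
set a := n.+1%:R `^ x.
have a0 : a != 0 by rewrite gt_eqF ?powR_gt0 ?ltr0n.
have f0 : (n.+1)`!%:R != 0 :> R by rewrite pnatr_eq0 -lt0n fact_gt0.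
have n0 : n.+1%:R != 0 :> R by rewrite pnatr_eq0.
move: f0 n0 a0; move: (\prod_(_ < _) _) a (n.+1%:R : R) (_`!%:R : R) => p a c d.
by move=> d0 c0 a0; field; rewrite ?a0 ?c0 ?d0.
Qed.

Lemma cvg_gauss_prod_pred x l : (gauss_prod (x + 1) n @[n --> \oo] --> l)%classic ->
  (gauss_prod x n @[n --> \oo] --> x * l)%classic.
Proof.
rewrite -cvg_shiftS => Gl; rewrite -cvg_shiftS.
have r1 := cvg_shift_ratio (x + 1).
have : (x * gauss_prod (x + 1) n.+1 / ((x + 1 + n.+1%:R) / n.+1%:R)
    @[n --> \oo] --> x * l / 1)%classic.
  apply: cvgM; last by apply: cvgV => //; exact: oner_neq0.
  by apply: cvgM => //; exact: cvg_cst.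
rewrite divr1; apply: cvg_trans; apply: near_eq_cvg; near=> n.
have r0 : 0 < (x + 1 + n.+1%:R) / n.+1%:R.
  by near: n; exact: (cvgr_gt (1 : R)).
by rewrite /= -gauss_prod_shift mulfK// gt_eqF.
Unshelve. all: by end_near.
Qed.

Lemma cvg_gauss_prod_succ x l : x != 0 -> (gauss_prod x n @[n --> \oo] --> l)%classic ->
  (gauss_prod (x + 1) n @[n --> \oo] --> l / x)%classic.
Proof.
move=> x0; rewrite -cvg_shiftS => Gl; rewrite -cvg_shiftS.
have r1 := cvg_shift_ratio (x + 1).
have : (gauss_prod x n.+1 * ((x + 1 + n.+1%:R) / n.+1%:R) / x
    @[n --> \oo] --> l * 1 / x)%classic.
  by apply: cvgM; [exact: cvgM|exact: cvg_cst].
rewrite mulr1; apply: cvg_trans; apply: near_eq_cvg; apply: nearW => n.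
by rewrite /= gauss_prod_shift mulrAC divff// mul1r.
Qed.

(** Convergence spreads from [0, 1] to the whole line by unit shifts, by induction on a bound for
    the absolute value. A shift from [y - 1] up to [y] occurs only for [y > 1], so the division by
    [y - 1] is legitimate. *)
Lemma ex_cvg_gauss_prod x : exists l, (gauss_prod x n @[n --> \oo] --> l)%classic.
Proof.
suff H n y : `|y| <= n.+1%:R -> exists l, (gauss_prod y n @[n --> \oo] --> l)%classic.
  apply: (H (Num.bound `|x|)); apply: ltW; apply: (lt_trans (archi_boundP (normr_ge0 x))).
  by rewrite ltr_nat.
elim: n y => [|n IH] y.
  rewrite ler_norml => /andP[y0 y1].
  have [yge|ylt] := leP 0 y; first by apply: cvg_gauss_prod01; rewrite yge.
  have [|l yl] := @cvg_gauss_prod01 (y + 1); first by apply/andP; split; lra.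
  by exists (y * l); exact: cvg_gauss_prod_pred.
rewrite ler_norml => /andP[y0 y1].
have [yn|yn] := leP `|y| n.+1%:R; first exact: IH.
have n1 : 1 <= n.+1%:R :> R by rewrite ler1n.
rewrite -natr1 in y0 y1.
have [yge|ylt] := leP 0 y.
  rewrite ger0_norm// in yn.
  have [|l yl] := IH (y - 1); first by rewrite ler_norml; apply/andP; split; lra.
  exists (l / (y - 1)); rewrite -{1}(subrK 1 y); apply: cvg_gauss_prod_succ => //.
  by rewrite gt_eqF//; lra.
have [|l yl] := IH (y + 1); first by rewrite ler_norml; apply/andP; split; lra.
by exists (y * l); exact: cvg_gauss_prod_pred.
Qed.

Lemma cvg_rGamma x : (gauss_prod x n @[n --> \oo] --> rGamma x)%classic.
Proof. by have [l xl] := ex_cvg_gauss_prod x; apply/cvg_ex; exists l. Qed.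

(** * Euler's reflection formula *)

(** The factor [x + i] of one product pairs with [i - x] of the other, giving [i^2 (1 - x^2 / i^2)];
    the first factor [x] and the last factor [1 - x + n.+1%:R] stay unpaired. *)
Lemma gauss_prod_reflect x n : gauss_prod x n.+1 * gauss_prod (1 - x) n.+1 =
  x * \prod_(i < n.+1) (1 - x ^+ 2 / i.+1%:R ^+ 2) * ((1 - x + n.+1%:R) / n.+1%:R).
Proof.
have H m : \prod_(i < m.+1) (x + i%:R) * \prod_(i < m.+1) (1 - x + i%:R) =
    x * \prod_(i < m) (1 - x ^+ 2 / i.+1%:R ^+ 2) * m`!%:R ^+ 2 * (1 - x + m%:R).
  elim: m => [|m IH]; first by rewrite !big_ord1 big_ord0 fact0 expr1n !addr0 !mulr1.
  rewrite [LHS]mulrC big_ord_recr/= mulrC big_ord_recr/=.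
  rewrite [LHS]mulrACA IH [in RHS]big_ord_recr/= factS natrM.
  have n0 : m.+1%:R != 0 :> R by rewrite pnatr_eq0.
  move: n0; rewrite -natr1; move: (\prod_(_ < _) _) (m%:R : R) (_`!%:R : R) => p a f a0.
  by field.
rewrite /gauss_prod mulrACA H -invfM.
have -> : n.+1%:R `^ (1 - x) = n.+1%:R / n.+1%:R `^ x.
  by rewrite powRB ?pnatr_eq0 ?implybT// powRr1 ?ler0n.
set a := n.+1%:R `^ x.
have a0 : a != 0 by rewrite gt_eqF ?powR_gt0 ?ltr0n.
have f0 : (n.+1)`!%:R != 0 :> R by rewrite pnatr_eq0 -lt0n fact_gt0.
have n0 : n.+1%:R != 0 :> R by rewrite pnatr_eq0.
move: f0 n0 a0; move: (\prod_(_ < _) _) a (n.+1%:R : R) (_`!%:R : R) => p a c d.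
by move=> d0 c0 a0; field; rewrite ?a0 ?c0 ?d0.
Qed.

Lemma rGamma_reflect x : rGamma x * rGamma (1 - x) = sin (pi * x) / pi.
Proof.
have L : (gauss_prod x n.+1 * gauss_prod (1 - x) n.+1 @[n --> \oo] -->
    rGamma x * rGamma (1 - x))%classic.
  by apply: cvgM; rewrite (cvg_shiftS (gauss_prod _)); exact: cvg_rGamma.
rewrite -(cvg_lim _ L)//; apply: cvg_lim => //.
under eq_fun do rewrite gauss_prod_reflect.
rewrite -[X in nbhs X]mulr1; apply: cvgM (cvg_shift_ratio (1 - x)).
rewrite (cvg_shiftS (fun n => x * \prod_(i < n) (1 - x ^+ 2 / i.+1%:R ^+ 2))).
exact: cvg_sine_product.
Qed.

(** * Trigonometric values and the product of [G12] and [G21] *)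

(** Otherwise the fractional part of [x] lies strictly between 0 and 1, where the sine is positive,
    although translation by an integer preserves the zeros. *)
Lemma sin_piM_eq0 x : sin (pi * x) = 0 -> exists m : int, x = m%:~R.
Proof.
move=> sx0; exists (Num.floor x); apply/eqP; rewrite -subr_eq0; apply/negPn/negP => f0.
have /andP[fx xf] := floor_itv x.
suff : sin (pi * (x - (Num.floor x)%:~R)) = 0.
  apply/eqP; rewrite gt_eqF// sin_gt0_pi// mulr_gt0 ?pi_gt0//=; last first.
    by rewrite lt0r f0 subr_ge0.
  by rewrite gtr_pMr ?pi_gt0// ltrBlDl -intrD1.
rewrite mulrBr sinB sx0 mul0r sub0r [pi * _%:~R]mulrC.
suff -> : sin ((Num.floor x)%:~R * pi) = 0 :> R by rewrite mulr0 oppr0.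
case: (Num.floor x) => n; first exact: sin_natrM_pi.
by rewrite NegzE intrN mulNr sinN sin_natrM_pi oppr0.
Qed.

(** Doubling pi/3 gives [pi - pi/3], so the cosine [c] satisfies [2 c^2 - 1 = - c]; its sign selects
    the root 1/2. *)
Lemma cos_pi3 : cos (pi / 3) = 2^-1 :> R.
Proof.
set c := cos _.
have c0 : 0 <= c.
  by apply: cos_ge0_pihalf; have := pi_gt0 R; lra.
have h : c ^+ 2 *+ 2 - 1 = - c.
  rewrite -cos_mulr2n (_ : pi / 3 *+ 2 = - (pi / 3) + pi) ?cosDpi ?cosN//.
  by field.
have : (2 * c - 1) * (c + 1) = 0.
  transitivity (c ^+ 2 *+ 2 - 1 + c); first by ring.
  by rewrite h addNr.
move=> /eqP; rewrite mulf_eq0 => /orP[/eqP|/eqP]; lra.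
Qed.

(** Product-to-sum formula: the two angles differ by pi/3 and add up to [theta x + pi / 2]. *)
Lemma sin_mul_sin x : sin (pi * ((2 + x) / 12)) * sin (pi * ((6 + x) / 12)) =
  (sin (theta x) + 2^-1) / 2.
Proof.
set u := pi * _; set v := pi * _.
have h1 : cos (v - u) = 2^-1 by rewrite -cos_pi3 /u /v; congr cos; field.
have h2 : cos (u + v) = - sin (theta x).
  by rewrite -cosDpihalf /u /v /theta; congr cos; field.
by move: h1 h2; rewrite cosB cosD => h1 h2; lra.
Qed.

Lemma G12_mul_G21 x : sin (theta x) != 0 -> 16%:R * (G12 x * G21 x) = 1 + Csc x / 2%:R.
Proof.
move=> s0.
have p0 : pi != 0 :> R by rewrite gt_eqF ?pi_gt0.
have E1 : Gamma ((1 + x) / 6%:R) * Gamma ((5%:R - x) / 6%:R) = pi / sin (theta x).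
  have -> : (5%:R - x) / 6%:R = 1 - (1 + x) / 6%:R by field.
  by rewrite /Gamma -invfM rGamma_reflect invf_div /theta [pi * _]mulrC.
have E2 : rGamma ((2%:R + x) / 12%:R) * rGamma ((10%:R - x) / 12%:R) =
    sin (pi * ((2 + x) / 12)) / pi.
  by rewrite -rGamma_reflect; congr (_ * rGamma _); field.
have E3 : rGamma ((6%:R + x) / 12%:R) * rGamma ((6%:R - x) / 12%:R) =
    sin (pi * ((6 + x) / 12)) / pi.
  by rewrite -rGamma_reflect; congr (_ * rGamma _); field.
have E4 := sin_mul_sin x.
have E5 : Num.sqrt pi * Num.sqrt pi = pi :> R by rewrite -expr2 sqr_sqrtr ?pi_ge0.
rewrite /G12 /G21 /Csc -rmorphM.
have -> : 16%:R = (16%:R)%:C :> R[i] by rewrite rmorph_nat.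
have -> : 2%:R = (2%:R)%:C :> R[i] by rewrite rmorph_nat.
rewrite -fmorph_div -rmorphM -[1 in RHS](rmorph1 (real_complex R)) -rmorphD; congr (_%:C).
move: E1 E2 E3 E4 E5 s0 p0.
move: (sin (theta _)) => s; move: (sin _) => s1; move: (sin _) => s2.
move: (Gamma _) => g1; move: (Gamma _) => g2.
move: (rGamma _) => r1; move: (rGamma _) => r2; move: (rGamma _) => r3; move: (rGamma _) => r4.
move: (Num.sqrt _) => q; move: (@pi R) => p E1 E2 E3 E4 E5 s0 p0.
(* The six Gamma arguments are grouped in pairs of sum 1. All powers of pi cancel, leaving
   [2 * s1 * s2 / s]. *)
transitivity ((q * q) * (g1 * g2) * (r1 * r2) * (r3 * r4) * 2); first by field.
rewrite E1 E2 E3 E5; transitivity (2 * (s1 * s2) / s); first by field; rewrite s0 p0.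
by rewrite E4; field.
Qed.

(** * Two-by-two matrices and the powers of [rho(T)] *)

Lemma mx2E (F : nzRingType) (A : 'M[F]_2) : A = mx2 (A 0 0) (A 0 1) (A 1 0) (A 1 1).
Proof.
apply/matrixP => i j; rewrite mxE.
by case: i => -[|[|//]] ?; case: j => -[|[|//]] ? /=; congr (A _ _); exact: val_inj.
Qed.

Lemma mulmx2 (F : nzRingType) (a b c d a' b' c' d' : F) : mx2 a b c d * mx2 a' b' c' d' =
  mx2 (a * a' + b * c') (a * b' + b * d') (c * a' + d * c') (c * b' + d * d').
Proof. by rewrite [LHS]mx2E !mxE !big_ord_recl !big_ord0 !mxE /= !addr0. Qed.

Lemma addmx2 (F : nzRingType) (a b c d a' b' c' d' : F) : mx2 a b c d + mx2 a' b' c' d' =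
  mx2 (a + a') (b + b') (c + c') (d + d').
Proof. by rewrite [LHS]mx2E !mxE. Qed.

Lemma scalemx2 (F : nzRingType) (a b c d e : F) : e *: mx2 a b c d =
  mx2 (e * a) (e * b) (e * c) (e * d).
Proof. by rewrite [LHS]mx2E !mxE. Qed.

Lemma scalar_mx2 (F : nzRingType) : 1%:M = mx2 1 0 0 1 :> 'M[F]_2.
Proof. by rewrite [LHS]mx2E !mxE. Qed.

Lemma Z_D x (s t : int) : Z_ x (s + t) = Z_ x s * Z_ x t.
Proof.
rewrite /Z_ /expi intrD mulrDr mulrDl cosD sinD.
by apply/eqP; rewrite eq_complex /= eqxx/= addrC.
Qed.

Lemma Z_0 x : Z_ x 0 = 1.
Proof. by rewrite /Z_ /expi !(mulr0, mul0r) cos0 sin0. Qed.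

(** With [b = 4 i G12], these matrices share the eigenvectors [(1, 0)] and [(-b, 1)], with
    eigenvalues 1 and [Z_t]; hence they multiply as the [Z_t] do. *)
Definition genT_pow x (t : int) : 'M[R[i]]_2 :=
  mx2 1 (4%:R * 'i%C * G12 x * (1 - Z_ x t)) 0 (Z_ x t).

Lemma genT_powD x (s t : int) : genT_pow x (s + t) = genT_pow x s * genT_pow x t.
Proof. by rewrite /genT_pow mulmx2 Z_D; congr mx2; ring. Qed.

Lemma genT_pow0 x : genT_pow x 0 = 1.
Proof. by rewrite /genT_pow Z_0 subrr mulr0 -scalar_mx2. Qed.

Lemma genT_exprz x (t : int) : rho_gen x genT ^ t = genT_pow x t.
Proof.
have H n : rho_gen x genT ^+ n = genT_pow x n.
  elim: n => [|n IH]; first by rewrite expr0 genT_pow0.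
  by rewrite exprS IH intS genT_powD.
case: t => n; first exact: H.
rewrite NegzE -exprnN H.
have V : genT_pow x n.+1 * genT_pow x (- n.+1%:Z) = 1 by rewrite -genT_powD subrr genT_pow0.
have U : genT_pow x n.+1 \is a GRing.unit.
  by apply/unitrP; exists (genT_pow x (- n.+1%:Z)); rewrite V -genT_powD addNr genT_pow0.
by apply: (mulrI U); rewrite divrr.
Qed.

(* The hypothesis on [W] says that the matrix being cubed has trace [-W / 2]. *)
Lemma cube_mx2 (F : numFieldType) (b c Z W : F) : W = (Z - 1) * (2 * (b * c) - 2) ->
  (mx2 1 (b * (1 - Z)) 0 Z * mx2 (-1) 0 c 1) ^+ 3 =
  (- (1 / 2) * Z * W) *: 1%:M + (W ^+ 2 + 4 * Z) *: mx2
    (- (1 / 8) * (2 * Z + W)) (- (b / 4 * (Z - 1))) (c / 4 * Z) (1 / 4 * Z).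
Proof.
(* Behind the entrywise check is Cayley-Hamilton: trace [-W/2] and determinant [-Z] give [N^3 = - (Z
   W / 2) E + (W^2 + 4 Z) (N / 4)] for the matrix [N] being cubed. *)
move=> ->; rewrite !exprS expr0 mulr1 scalar_mx2 !mulmx2 !scalemx2 addmx2.
by congr mx2; field.
Qed.

(** * The congruence conditions and the closed form *)

(** A zero of the sine forces [k = 6 m - 1] with [m] an integer; even [m] gives the class of 11 and
    odd [m] that of 5. *)
Lemma sin_theta_neq0 (k : rat) : ~ congr12 k 5 -> ~ congr12 k 11 ->
  sin (theta (ratr k : R)) != 0.
Proof.
move=> k5 k11; apply/eqP; rewrite /theta mulrC => /sin_piM_eq0[m].
(* As [ratr] is an injective field morphism, the equation descends from [R] to the rationals. *)
have : ((1 + k) / 6%:R == m%:~R) = ((1 + ratr k) / 6%:R == m%:~R :> R).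
  rewrite -(inj_eq (fmorph_inj (@ratr R))) fmorph_div rmorphD rmorph1 rmorph_nat.
  by rewrite rmorph_int.
move=> + /eqP mE; rewrite mE => /eqP km {mE}.
have {km} kE : k = 6%:R * m%:~R - 1 by rewrite -km; field.
have mE := divz_eq m 2.
have : (m %% 2)%Z = 0 \/ (m %% 2)%Z = 1.
  have := modz_ge0 m (isT : 2%:Z != 0); have := ltz_pmod m (isT : 0 < 2%:Z).
  by case: (m %% 2)%Z => [[|[|]]|]//; [left|right].
case=> mod2; rewrite mod2 in mE.
  apply: k11; exists ((m %/ 2)%Z - 1).
  by rewrite kE {1}mE !rmorphD rmorphN rmorphM /=; ring.
apply: k5; exists (m %/ 2)%Z.
by rewrite kE {1}mE !rmorphD rmorphM /=; ring.
Qed.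
End ClosedForm.

Theorem theorem4p3 (R : realType) (k : rat)
    (hk0 : ~ congr12 k 0) (hk4 : ~ congr12 k 4)
    (hk5 : ~ congr12 k 5) (hk11 : ~ congr12 k 11)
    (t : int) (ht : t <> 0) :
  let x : R := ratr k in
  [/\ M_ x t = (rho_gen x genT ^ t * rho_gen x genS) ^+ 3,
      M_ x t =
        (- (1 / 2%:R) * Z_ x t * W_ x t) *: 1%:M
        + K_ x t *: mx2
            (- (1 / 8%:R) * (2%:R * Z_ x t + W_ x t))
            (- ('i%C * G12 x * (Z_ x t - 1)))
            (- ('i%C * G21 x * Z_ x t))
            (1 / 4%:R * Z_ x t),
      K_ x t = Csc x ^+ 2 * (Z_ x t - 1) ^+ 2 + 4%:R * Z_ x t
    & K_ x t = W_ x t ^+ 2 + 4%:R * Z_ x t].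
Proof.
have s0 := sin_theta_neq0 R hk5 hk11.
move=> x.
have C0 : Csc x != 0.
  by rewrite /Csc -(rmorph0 (real_complex R)) (inj_eq (fmorph_inj _)) invr_eq0.
have K1 : K_ x t = Csc x ^+ 2 * (Z_ x t - 1) ^+ 2 + 4%:R * Z_ x t.
  by rewrite /K_ mulrDr [X in _ + X]mulrC mulfVK// expf_neq0.
have K2 : K_ x t = W_ x t ^+ 2 + 4%:R * Z_ x t.
  by rewrite K1 /W_ exprMn [_ ^+ 2 * Csc x ^+ 2]mulrC.
have M1 : M_ x t = (rho_gen x genT ^ t * rho_gen x genS) ^+ 3.
  by rewrite /M_ /rho /wordTtS3 /= !big_cons big_nil /= expr1z mulr1 !exprS expr0 mulr1 !mulrA.
split => //; rewrite M1 K2 genT_exprz /genT_pow.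
(* Here [b = 4 i G12] and [c = - 4 i G21], so [b c = 16 G12 G21]. The trace condition reduces to
   [2 b c - 2 = C]. *)
rewrite (@cube_mx2 _ _ _ _ (W_ x t)).
  by congr (_ + _ *: mx2 _ _ _ _); field.
have i2 : 'i%C ^+ 2 = -1 :> R[i] by rewrite sqr_i.
have : 2%:R * (16%:R * (G12 x * G21 x)) - 2%:R = Csc x.
  by rewrite (G12_mul_G21 s0) -/x; move: (Csc x) => c; field.
rewrite /W_ => <-; congr (_ * _).
by ring: i2.
Qed.
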